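(* Let $(L,h)$ and $(N,g)$ be pseudo-Riemannian manifolds, let $w:L\to(0,\infty)$ be a smooth function, let $M=L\times_w N$ be the warped product, and let $S$ be a submanifold of $N$. Then $S$ is geodesic in $N$ if and only if $L\times S$ is geodesic in $M$.
   Context: The warped product $L\times_w N$ is the product manifold $L\times N$ endowed with the metric $h\oplus w g$, i.e. at $(x,y)$ the metric is $h_x\oplus w(x)g_y$. A submanifold $S$ of a pseudo-Riemannian manifold is called geodesic if it is totally geodesic: for all vector fields $X,Y$ tangent to $S$, the Levi-Civita covariant derivative $\nabla_XY$ along $S$ is tangent to $S$ (for a non-degenerate submanifold this means that its second fundamental form vanishes). *)

(* Defs.v *)
From HB Require Import structures.
From mathcomp Require Import all_boot all_order all_algebra.
From mathcomp Require Import mathcomp_extra boolp classical_sets functions.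
From mathcomp Require Import cardinality reals topology normedtype landau derive.

Set Implicit Arguments.
Unset Strict Implicit.
Unset Printing Implicit Defensive.

Import Order.TTheory GRing.Theory Num.Theory.
Import numFieldNormedType.Exports.

Local Open Scope classical_set_scope.
Local Open Scope ring_scope.

Section Smooth.
Variable R : realType.

(* Meaningful only when U is open. *)
Fixpoint Ck (V W : normedModType R) (k : nat) (U : set V) (f : V -> W) : Prop :=
  if k is k'.+1 then
    (forall x, U x -> differentiable f x) /\ forall v, Ck k' U ('D_v f)
  else forall x, U x -> {for x, continuous f}.

Definition smooth_on (V W : normedModType R) (U : set V) (f : V -> W) :=
  forall k, Ck k U f.

Lemma smooth_differentiable (V W : normedModType R) (U : set V) (f : V -> W) x :
  smooth_on U f -> U x -> differentiable f x.
Proof. by move=> /(_ 1%N)[+ _]; apply. Qed.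

Lemma Ck_subset (V W : normedModType R) k (U U' : set V) (f : V -> W) :
  U `<=` U' -> Ck k U' f -> Ck k U f.
Proof.
move=> sUU'; elim: k f => [|k IHk] f /=; first by move=> fC x /sUU'; exact: fC.
by move=> [fd fC]; split=> [x /sUU'|v]; [exact: fd|exact: IHk].
Qed.

Lemma near_eq_differentiable (V W : normedModType R) (f g : V -> W) (x : V) :
  (\near x, f x = g x) -> differentiable f x -> differentiable g x.
Proof.
move=> fg df; have -> : g = f + (g - f) by apply/funext => y; rewrite !fctE addrC subrK.
apply: differentiableD => //; set d := g - f.
have d0 : \near x, d x = 0 by apply: filterS fg => y; rewrite /d !fctE => ->; rewrite subrr.
have dx : d x = 0 := nbhs_singleton d0.
pose z : {linear V -> W} := \0.
have zC : continuous z by exact: cst_continuous.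
have E : d \o shift x = cst (d x) + z +o_ (0 : V) id.
  apply/eqaddoP => e e0; move: d0; rewrite (near_shift 0) subr0 => d0; near=> y.
  rewrite !fctE dx addr0 subr0 /= (_ : d (y + x) = 0).
    by rewrite normr0 mulr_ge0 // ltW.
  by near: y; exact: d0.
have zd : 'd d x = z :> (V -> W) by exact: diff_unique.
by apply/diff_locallyP; rewrite zd.
Unshelve. all: by end_near. Qed.

Lemma Ck_eq (V W : normedModType R) k (U : set V) (f g : V -> W) :
  open U -> (forall x, U x -> f x = g x) -> Ck k U f -> Ck k U g.
Proof.
move=> oU; have nfg h h' x : U x -> (forall x, U x -> h x = h' x) ->
    \near x, h x = h' x :> W.
  by move=> Ux hh'; apply: filterS (open_nbhs_nbhs (conj oU Ux)).
elim: k f g => [|k IHk] f g fg /=.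
  move=> fC x Ux; have e := nfg _ _ x Ux fg.
  have gf : g @ x --> f x by apply: cvg_trans (fC x Ux); exact: near_eq_cvg.
  by move: gf; rewrite fg.
move=> [fd fC]; split=> [x Ux|v].
  exact: near_eq_differentiable (nfg _ _ x Ux fg) (fd x Ux).
by apply: IHk (fC v) => x Ux; apply: near_eq_derive; exact: nfg.
Qed.

Lemma CkD (V W : normedModType R) k (U : set V) (f g : V -> W) :
  open U -> Ck k U f -> Ck k U g -> Ck k U (fun x => f x + g x).
Proof.
move=> oU; elim: k f g => [|k IHk] f g /=.
  by move=> fC gC x Ux; apply: continuousD; [exact: fC|exact: gC].
move=> [fd fC] [gd gC]; split=> [x Ux|v].
  by apply: differentiableD; [exact: fd|exact: gd].
apply: Ck_eq (IHk _ _ (fC v) (gC v)) => // x Ux.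
by rewrite -deriveD //; apply: diff_derivable; [exact: fd|exact: gd].
Qed.

Lemma Ck_cst (V W : normedModType R) k (U : set V) (a : W) : Ck k U (cst a : V -> W).
Proof.
elim: k a => [|k IHk] a /=; first by move=> x _; exact: cst_continuous.
split=> [x _|v]; first exact: differentiable_cst.
have -> : 'D_v (cst a) = cst 0 :> (V -> W) by apply/funext => x; rewrite derive_cst.
exact: IHk.
Qed.

Lemma Ck_sum (V W : normedModType R) (I : Type) (r : seq I) k (U : set V)
    (f : I -> V -> W) :
  open U -> (forall i, Ck k U (f i)) -> Ck k U (fun x => \sum_(i <- r) f i x).
Proof.
move=> oU fC; elim: r => [|i r IHr].
  by under eq_fun do rewrite big_nil; exact: Ck_cst.
by under eq_fun do rewrite big_cons; exact: CkD.
Qed.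

Lemma Ck_lin_comp (V W W' : normedModType R) k (U : set V) (f : V -> W)
    (l : {linear W -> W'}) :
  open U -> continuous l -> Ck k U f -> Ck k U (fun x => l (f x)).
Proof.
move=> oU lC; elim: k f => [|k IHk] f /=.
  by move=> fC x Ux; apply: continuous_comp; [exact: fC|exact: lC].
have ld y := linear_differentiable y lC.
move=> [fd fC]; split=> [x Ux|v]; first exact: differentiable_comp (fd x Ux) (ld _).
apply: Ck_eq (IHk _ (fC v)) => // x Ux.
rewrite [RHS]deriveE; last exact: differentiable_comp (fd x Ux) (ld _).
by rewrite diff_comp //= ?diff_lin // -?deriveE //; exact: fd.
Qed.

Lemma Ck_comp_lin (V W W' : normedModType R) k (U : set W) (f : W -> W')
    (l : {linear V -> W}) :
  open U -> continuous l -> Ck k U f -> Ck k (l @^-1` U) (fun x => f (l x)).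
Proof.
move=> oU lC; elim: k f => [|k IHk] f /=.
  by move=> fC x Ux; apply: continuous_comp; [exact: lC|exact: fC].
have ld y := linear_differentiable y lC.
move=> [fd fC]; split=> [x Ux|v]; first exact: differentiable_comp (ld _) (fd _ Ux).
apply: Ck_eq (IHk _ (fC (l v))) => [|x Ux]; first exact: open_comp.
rewrite [RHS]deriveE; last exact: differentiable_comp (ld _) (fd _ Ux).
by rewrite diff_comp //= ?diff_lin // -?deriveE //; exact: fd.
Qed.

Lemma CkW (V W : normedModType R) k (U : set V) (f : V -> W) :
  Ck k.+1 U f -> Ck k U f.
Proof.
elim: k f => [|k IHk] f [fd fC].
  by move=> x /fd; exact: differentiable_continuous.
by split=> // v; apply: IHk; exact: fC.
Qed.

Lemma CkM (V : normedModType R) k (U : set V) (f g : V -> R) :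
  open U -> Ck k U f -> Ck k U g -> Ck k U (fun x => f x * g x).
Proof.
move=> oU; elim: k f g => [|k IHk] f g.
  by move=> fC gC x Ux; apply: continuousM; [exact: fC|exact: gC].
move=> fk gk; have := CkW fk; have := CkW gk; move: fk gk => [fd fC] [gd gC] g0 f0.
split=> [x Ux|v].
  by apply: differentiableM; [exact: fd|exact: gd].
apply: Ck_eq (CkD oU (IHk _ _ f0 (gC v)) (IHk _ _ g0 (fC v))) => // x Ux.
by rewrite [RHS]deriveM //; apply: diff_derivable; [exact: fd|exact: gd].
Qed.

End Smooth.

Section Manifold.
Variable R : realType.

Record chart (n : nat) (T : topologicalType) := Chart {
  chart_dom : set T;
  chart_map : T -> 'rV[R]_n;
  chart_inv : 'rV[R]_n -> T;
  chart_dom_open : open chart_dom;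
  chart_image_open : open (chart_map @` chart_dom);
  chart_mapK : forall p, chart_dom p -> chart_inv (chart_map p) = p;
  chart_map_continuous : forall p, chart_dom p -> {for p, continuous chart_map};
  chart_inv_continuous : forall x, (chart_map @` chart_dom) x ->
    {for x, continuous chart_inv} }.

Definition chart_image n T (c : chart n T) : set 'rV[R]_n :=
  chart_map c @` chart_dom c.

(* The expression of f in the charts c and d, and the set where it is defined. *)
Definition local_expr m n T T' (c : chart m T) (d : chart n T') (f : T -> T') :
    'rV[R]_m -> 'rV[R]_n :=
  chart_map d \o f \o chart_inv c.

Definition local_dom m n T T' (c : chart m T) (d : chart n T') (f : T -> T') :
    set 'rV[R]_m :=
  chart_map c @` (chart_dom c `&` f @^-1` chart_dom d).

(* The atlas need not be maximal: smoothness on M, tensor fields and vector     *)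
(* fields are all determined by their components in an arbitrary atlas.         *)
Record manifold (n : nat) := Manifold {
  carrier :> topologicalType;
  atlas : Type;
  chart_at : atlas -> chart n carrier;
  manifold_hausdorff : hausdorff_space carrier;
  manifold_second_countable : @second_countable carrier;
  atlas_cover : forall p, exists i, chart_dom (chart_at i) p;
  atlas_compat : forall i j,
    smooth_on (local_dom (chart_at i) (chart_at j) id)
              (local_expr (chart_at i) (chart_at j) id) }.

Definition smooth_fun n (M : manifold n) (W : normedModType R) (f : M -> W) :=
  forall i : atlas M,
    smooth_on (chart_image (chart_at i)) (f \o chart_inv (chart_at i)).

Definition smooth_map m n (M : manifold m) (N : manifold n) (f : M -> N) :=
  continuous f /\
  forall (i : atlas M) (j : atlas N),
    smooth_on (local_dom (chart_at i) (chart_at j) f)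
              (local_expr (chart_at i) (chart_at j) f).

(* The matrix of the differential of f at p: with row vectors, it acts on       *)
(* components of tangent vectors by right multiplication.                       *)
Definition jacobian_at m n (M : manifold m) (N : manifold n) (f : M -> N)
    (i : atlas M) (j : atlas N) (p : M) : 'M[R]_(m, n) :=
  'J (local_expr (chart_at i) (chart_at j) f) (chart_map (chart_at i) p).

(* A vector field X is given by its components X i p in the coordinate frame of *)
(* each chart i around p; values at p outside of the domain of i are junk.      *)
Record vector_field n (M : manifold n) := VectorField {
  vf_comp :> atlas M -> M -> 'rV[R]_n;
  vf_smooth : forall i,
    smooth_on (chart_image (chart_at i)) (vf_comp i \o chart_inv (chart_at i));
  vf_change : forall i j p,
    chart_dom (chart_at i) p -> chart_dom (chart_at j) p ->
    vf_comp j p = vf_comp i p *m jacobian_at (@id M) i j p }.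

Record metric_tensor n (M : manifold n) := MetricTensor {
  metric_mx :> atlas M -> M -> 'M[R]_n;
  metric_smooth : forall i,
    smooth_on (chart_image (chart_at i)) (metric_mx i \o chart_inv (chart_at i));
  metric_sym : forall i p, chart_dom (chart_at i) p ->
    (metric_mx i p)^T = metric_mx i p;
  metric_nondegenerate : forall i p, chart_dom (chart_at i) p ->
    metric_mx i p \in unitmx;
  metric_change : forall i j p,
    chart_dom (chart_at i) p -> chart_dom (chart_at j) p ->
    metric_mx i p =
      jacobian_at (@id M) i j p *m metric_mx j p *m (jacobian_at (@id M) i j p)^T }.

Definition pderiv n (W : normedModType R) (a : 'I_n) (f : 'rV[R]_n -> W) :
    'rV[R]_n -> W :=
  'D_(delta_mx 0 a) f.

(* The vector of components of the covariant derivative of the b-th coordinate  *)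
(* field along the a-th one, for the Levi-Civita connection:                    *)
(*   Gamma^c_ab = 1/2 sum_d g^dc (d_a g_bd + d_b g_ad - d_d g_ab).              *)
Definition christoffel n (M : manifold n) (g : metric_tensor M) (i : atlas M)
    (p : M) (a b : 'I_n) : 'rV[R]_n :=
  let G b d x := g i (chart_inv (chart_at i) x) b d in
  let x := chart_map (chart_at i) p in
  2^-1 *: (\row_d (pderiv a (G b d) x + pderiv b (G a d) x - pderiv d (G a b) x)
           *m invmx (g i p)).

(* Injectively immersed submanifolds; those for which the inclusion is moreover *)
(* a topological embedding are a particular case.                               *)
Record submanifold (k n : nat) (N : manifold n) := Submanifold {
  sub_manifold :> manifold k;
  incl : sub_manifold -> N;
  incl_injective : injective incl;
  incl_smooth : smooth_map incl;
  incl_immersion : forall i j p,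
    chart_dom (chart_at i) p -> chart_dom (chart_at j) (incl p) ->
    row_free (jacobian_at incl i j p) }.

Section Geodesic.
Variables (n k : nat) (N : manifold n) (g : metric_tensor N).
Variable S : submanifold k N.

(* Components of Y, seen as a field along the inclusion, in the chart j of N.   *)
Definition push (Y : vector_field S) (i : atlas S) (j : atlas N) (p : S) :
    'rV[R]_n :=
  Y i p *m jacobian_at (@incl k n N S) i j p.

(* The covariant derivative of Y in the direction X along S, at p.              *)
Definition covariant_derivative (X Y : vector_field S) (i : atlas S)
    (j : atlas N) (p : S) : 'rV[R]_n :=
  'D_(X i p) (push Y i j \o chart_inv (chart_at i)) (chart_map (chart_at i) p) +
  \sum_(a < n) \sum_(b < n)
    (push X i j p 0 a * push Y i j p 0 b) *: christoffel g j (incl p) a b.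

(* The row space of jacobian_at incl i j p is the tangent space of S at p, in    *)
(* the chart j of N.                                                            *)
Definition geodesic :=
  forall (X Y : vector_field S) (i : atlas S) (j : atlas N) (p : S),
    chart_dom (chart_at i) p -> chart_dom (chart_at j) (incl p) ->
    (covariant_derivative X Y i j p <= jacobian_at (@incl k n N S) i j p)%MS.

End Geodesic.

End Manifold.

Section LeviCivita.
Variables (R : realType) (n : nat) (M : manifold R n) (g : metric_tensor M).
Variables (i : atlas M) (p : M).
Hypothesis ip : chart_dom (chart_at i) p.

Let x := chart_map (chart_at i) p.
Let G a b y := g i (chart_inv (chart_at i) y) a b.

Let GC a b d : pderiv d (G a b) x = pderiv d (G b a) x.
Proof.
have Ux : nbhs x (chart_image (chart_at i)).
  by apply: open_nbhs_nbhs; split; [exact: chart_image_open|exists p].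
apply: near_eq_derive; apply: filterS Ux => _ [q iq <-]; rewrite /G chart_mapK //.
by rewrite -[in LHS](metric_sym g iq) mxE.
Qed.

(* The connection is torsion-free and preserves the metric.                     *)
Lemma christoffelC a b : christoffel g i p a b = christoffel g i p b a.
Proof.
rewrite /christoffel; congr (_ *: (_ *m _)); apply/rowP => d.
by rewrite !mxE -/x -!/(G _ _) (GC a b) [X in X - _]addrC.
Qed.

Lemma christoffel_metric a b d :
  pderiv a (fun y => g i (chart_inv (chart_at i) y) b d)
    (chart_map (chart_at i) p) =
  (christoffel g i p a b *m g i p) 0 d + (christoffel g i p a d *m g i p) 0 b.
Proof.
rewrite /christoffel -!scalemxAl !mulmxKV ?metric_nondegenerate // !mxE.
rewrite -!/(G _ _) (GC d b).
move: (pderiv a _ x) (pderiv b _ x) (pderiv d _ x) => A B C.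
rewrite -mulrDr addrACA -opprD [C + B]addrC addrACA addrK.
by rewrite -[A + A]mulr2n -[A *+ 2]mulr_natl mulKf ?pnatr_eq0.
Qed.

End LeviCivita.

Section Product.
Variable R : realType.

Lemma mx_linear_continuous (W : normedModType R) m n
    (l : {linear 'M[R]_(m, n) -> W}) : continuous l.
Proof.
have -> : l = (fun A => \sum_(i < m) \sum_(j < n) A i j *: l (delta_mx i j)) :> (_ -> _).
  apply/funext => A; rewrite {1}(matrix_sum_delta A) !linear_sum.
  apply: eq_bigr => i _; rewrite linear_sum; apply: eq_bigr => j _.
  by rewrite linearZ.
suff H : Ck 0 setT (fun A : 'M[R]_(m, n) => \sum_(i < m) \sum_(j < n) A i j *: l (delta_mx i j)).
  by move=> A; exact: H.
apply: (Ck_sum _ openT) => i; apply: (Ck_sum _ openT) => j A _.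
exact/continuousZr_tmp/coord_continuous.
Qed.

Lemma smooth_mx_linear (V W : normedModType R) m n (U : set V)
    (f : V -> 'M[R]_(m, n)) (l : 'M[R]_(m, n) -> W) :
  open U -> linear l -> smooth_on U f -> smooth_on U (fun x => l (f x)).
Proof.
move=> oU linl fs k.
pose lM := GRing.isLinear.Build _ _ _ _ _ linl.
pose l' : {linear _ -> _} := HB.pack l lM.
exact: (Ck_lin_comp (l := l') oU (mx_linear_continuous (l := l')) (fs k)).
Qed.

Lemma smoothD (V W : normedModType R) (U : set V) (f g : V -> W) :
  open U -> smooth_on U f -> smooth_on U g -> smooth_on U (fun x => f x + g x).
Proof. by move=> oU fs gs k; exact: CkD. Qed.

Lemma smoothZ (V : normedModType R) m n (U : set V) (w : V -> R)
    (f : V -> 'M[R]_(m, n)) :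
  open U -> smooth_on U w -> smooth_on U f -> smooth_on U (fun x => w x *: f x).
Proof.
move=> oU ws fs k.
have fE : (fun x => w x *: f x) =
    (fun x => \sum_i \sum_j (w x * f x i j) *: delta_mx i j).
  apply/funext => x; rewrite {1}[f x]matrix_sum_delta scaler_sumr.
  apply: eq_bigr => i _; rewrite scaler_sumr.
  by apply: eq_bigr => j _; rewrite scalerA.
rewrite fE; apply: Ck_sum => // i; apply: Ck_sum => // j.
have e_lin : linear (fun r : R => r *: delta_mx i j : 'M[R]_(m, n)).
  by move=> a x y; rewrite scalerDl scalerA.
pose eM := GRing.isLinear.Build _ _ _ _ _ e_lin.
pose e : {linear R -> 'M[R]_(m, n)} := HB.pack (fun r : R => r *: delta_mx i j) eM.
have eC : continuous e by exact: scalel_continuous.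
apply: (Ck_lin_comp (l := e) oU eC); apply: CkM => //.
by apply: (@smooth_mx_linear _ _ _ _ _ _ (fun A => A i j)) => // a A B; rewrite !mxE.
Qed.

Section ProdFun.
Variables (m n m' n' : nat).

Definition prod_fun (F : 'rV[R]_m -> 'rV[R]_n) (G : 'rV[R]_m' -> 'rV[R]_n')
    (v : 'rV[R]_(m + m')) : 'rV[R]_(n + n') :=
  row_mx (F (lsubmx v)) (G (rsubmx v)).

Definition prod_dom (U : set 'rV[R]_m) (U' : set 'rV[R]_m') : set 'rV[R]_(m + m') :=
  lsubmx @^-1` U `&` rsubmx @^-1` U'.

Lemma prod_dom_open U U' : open U -> open U' -> open (prod_dom U U').
Proof.
by move=> oU oU'; apply: openI; apply: open_comp => // v _;
  [exact: continuous_lsubmx|exact: continuous_rsubmx].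
Qed.

Lemma smooth_lsubmx (W : normedModType R) U U' (F : 'rV[R]_m -> W) :
  open U -> smooth_on U F ->
  smooth_on (prod_dom U U') (fun v : 'rV[R]_(m + m') => F (lsubmx v)).
Proof.
move=> oU Fs k; apply: (@Ck_subset _ _ _ _ _ (lsubmx @^-1` U)) => [v []//|].
exact: Ck_comp_lin oU (@continuous_lsubmx _ _ _ _) (Fs k).
Qed.

Lemma smooth_rsubmx (W : normedModType R) U U' (G : 'rV[R]_m' -> W) :
  open U' -> smooth_on U' G ->
  smooth_on (prod_dom U U') (fun v : 'rV[R]_(m + m') => G (rsubmx v)).
Proof.
move=> oU Fs k; apply: (@Ck_subset _ _ _ _ _ (rsubmx @^-1` U')) => [v []//|].
exact: Ck_comp_lin oU (@continuous_rsubmx _ _ _ _) (Fs k).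
Qed.

Lemma smooth_prod_fun U U' F G : open U -> open U' ->
  smooth_on U F -> smooth_on U' G -> smooth_on (prod_dom U U') (prod_fun F G).
Proof.
move=> oU oU' Fs Gs; have oUU' := prod_dom_open oU oU'.
have -> : prod_fun F G =
    (fun v => row_mx (F (lsubmx v)) 0 + row_mx 0 (G (rsubmx v))).
  by apply/funext => v; rewrite add_row_mx addr0 add0r.
apply: smoothD => //.
  apply: (@smooth_mx_linear _ _ _ _ _ _ (fun A => row_mx A 0)) => //.
    by move=> a A B; rewrite scale_row_mx add_row_mx scaler0 addr0.
  exact: smooth_lsubmx.
apply: (@smooth_mx_linear _ _ _ _ _ _ (fun A => row_mx 0 A)) => //.
  by move=> a A B; rewrite scale_row_mx add_row_mx scaler0 addr0.
exact: smooth_rsubmx.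
Qed.

Lemma diff_prod_fun F G v :
  differentiable F (lsubmx v) -> differentiable G (rsubmx v) ->
  differentiable (prod_fun F G) v /\
  'J (prod_fun F G) v = block_mx ('J F (lsubmx v)) 0 0 ('J G (rsubmx v)).
Proof.
move=> dF dG.
have rl_lin : linear (fun A : 'rV[R]_n => row_mx A 0 : 'rV[R]_(n + n')).
  by move=> a A B; rewrite scale_row_mx add_row_mx scaler0 addr0.
have rr_lin : linear (fun A : 'rV[R]_n' => row_mx 0 A : 'rV[R]_(n + n')).
  by move=> a A B; rewrite scale_row_mx add_row_mx scaler0 addr0.
pose rlM := GRing.isLinear.Build _ _ _ _ _ rl_lin.
pose rl : {linear 'rV[R]_n -> 'rV[R]_(n + n')} := HB.pack (fun A : 'rV[R]_n => row_mx A 0 : 'rV[R]_(n + n')) rlM.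
pose rrM := GRing.isLinear.Build _ _ _ _ _ rr_lin.
pose rr : {linear 'rV[R]_n' -> 'rV[R]_(n + n')} := HB.pack (fun A : 'rV[R]_n' => row_mx 0 A : 'rV[R]_(n + n')) rrM.
have rlC := mx_linear_continuous (l := rl).
have rrC := mx_linear_continuous (l := rr).
have rld A := linear_differentiable A rlC.
have rrd A := linear_differentiable A rrC.
have ld := @differentiable_lsubmx R 1 m m' v.
have rd := @differentiable_rsubmx R 1 m m' v.
have lC := @continuous_lsubmx R 1 m m'.
have rC := @continuous_rsubmx R 1 m m'.
have FGE : prod_fun F G = (rl \o (F \o lsubmx)) + (rr \o (G \o rsubmx)).
  apply/funext => x; rewrite /prod_fun !fctE /=.
  by rewrite add_row_mx addr0 add0r.
have dFl : differentiable (F \o lsubmx) v by exact: differentiable_comp.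
have dGr : differentiable (G \o rsubmx) v by exact: differentiable_comp.
have d1 : differentiable (rl \o (F \o lsubmx)) v by exact: differentiable_comp.
have d2 : differentiable (rr \o (G \o rsubmx)) v by exact: differentiable_comp.
split; first by rewrite FGE; exact: differentiableD.
apply/row_matrixP => i; rewrite !rowE.
set e := delta_mx 0 i.
have dE1 : 'd (rl \o (F \o lsubmx)) v e = row_mx ('d F (lsubmx v) (lsubmx e)) 0.
  by rewrite (diff_comp dFl (rld _)) (diff_lin _ rlC) (diff_comp ld dF) (diff_lin _ lC).
have dE2 : 'd (rr \o (G \o rsubmx)) v e = row_mx 0 ('d G (rsubmx v) (rsubmx e)).
  by rewrite (diff_comp dGr (rrd _)) (diff_lin _ rrC) (diff_comp rd dG) (diff_lin _ rC).
rewrite /jacobian mul_rV_lin1 FGE (diffD d1 d2) [LHS]/= [X in X + _]dE1 [X in _ + X]dE2.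
rewrite -{3}(hsubmxK e) mul_row_block !mulmx0 addr0 add0r !mul_rV_lin1.
by rewrite add_row_mx addr0 add0r.
Qed.

End ProdFun.

Lemma hausdorff_prod (T T' : topologicalType) :
  hausdorff_space T -> hausdorff_space T' -> hausdorff_space (T * T')%type.
Proof.
move=> hT hT' [p p'] [q q'] pq; congr (_, _).
  apply: hT => A B pA qB.
  have [||[x x'] [[/= Ax _] [/= Bx _]]] := pq (A `*` setT) (B `*` setT).
  - by exists (A, setT) => //; split => //; exact: filterT.
  - by exists (B, setT) => //; split => //; exact: filterT.
  by exists x.
apply: hT' => A B pA qB.
have [||[x x'] [[/= _ Ax] [/= _ Bx]]] := pq (setT `*` A) (setT `*` B).
- by exists (setT, A) => //; split => //; exact: filterT.
- by exists (setT, B) => //; split => //; exact: filterT.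
by exists x'.
Qed.

Lemma open_prod (T T' : topologicalType) (A : set T) (B : set T') :
  open A -> open B -> open (A `*` B).
Proof.
move=> oA oB; rewrite openE => -[x y] [/= Ax By].
by exists (A, B) => //; split; exact: open_nbhs_nbhs.
Qed.

Lemma second_countable_prod (T T' : topologicalType) :
  @second_countable T -> @second_countable T' ->
  @second_countable (T * T')%type.
Proof.
move=> [B cB [oB bB]] [B' cB' [oB' bB']].
exists [set P.1 `*` P.2 | P in B `*` B'].
  by apply: sub_countable (card_image_le _ _) _; exact: countableX.
split=> [_ [[U U'] [/= /oB oU /oB' oU'] <-]|[x x'] A [[C C'] [/= xC x'C'] CA]].
  exact: open_prod.
have [U [BU Ux] UC] := bB x C xC; have [U' [BU' Ux'] UC'] := bB' x' C' x'C'.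
exists (U `*` U'); first by split=> //; exists (U, U').
by move=> [y y'] [/= Uy Uy']; apply: CA; split; [exact: UC|exact: UC'].
Qed.

Section Charts.
Variables (m n m' n' : nat) (T1 T2 T1' T2' : topologicalType).
Variables (c : chart R m T1) (d : chart R n T2).
Variables (c' : chart R m' T1') (d' : chart R n' T2').

Lemma chart_invP x : chart_image c x ->
  chart_dom c (chart_inv c x) /\ chart_map c (chart_inv c x) = x.
Proof. by move=> [p cp <-]; rewrite chart_mapK. Qed.

Lemma local_domE f :
  local_dom c d f =
  chart_image c `&` [set x | chart_dom d (f (chart_inv c x))].
Proof.
apply/seteqP; split=> [_ [p [cp dp] <-]|x [cx dx]].
  by split; [exists p|rewrite /= chart_mapK].
have [cp xE] := chart_invP cx.
by exists (chart_inv c x).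
Qed.

Lemma local_dom_open f : continuous f -> open (local_dom c d f).
Proof.
move=> fC; rewrite local_domE openE => x [cx dx].
apply: filterI; first by apply: open_nbhs_nbhs; split=> //; exact: chart_image_open.
have fcC : {for x, continuous (f \o chart_inv c)}.
  by apply: continuous_comp; [exact: chart_inv_continuous|exact: fC].
apply: (fcC (chart_dom d)).
by apply: open_nbhs_nbhs; split=> //; exact: chart_dom_open.
Qed.

Lemma prod_imageE (p : T1 -> 'rV[R]_m) (p' : T1' -> 'rV[R]_m') A A' :
  (fun x => row_mx (p x.1) (p' x.2)) @` (A `*` A') =
  prod_dom (p @` A) (p' @` A').
Proof.
apply/seteqP; split=> [_ [[x y] [/= Ax Ay] <-]|v [[x Ax xv] [y Ay yv]]].
  by split; rewrite /= ?row_mxKl ?row_mxKr; [exists x|exists y].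
by exists (x, y) => //=; rewrite xv yv hsubmxK.
Qed.

End Charts.

Section ProdChart.
Variables (m m' : nat) (T T' : topologicalType).
Variables (c : chart R m T) (c' : chart R m' T').

Definition prod_chart_dom : set (T * T')%type := chart_dom c `*` chart_dom c'.
Definition prod_chart_map (p : T * T') : 'rV[R]_(m + m') :=
  row_mx (chart_map c p.1) (chart_map c' p.2).
Definition prod_chart_inv (v : 'rV[R]_(m + m')) : T * T' :=
  (chart_inv c (lsubmx v), chart_inv c' (rsubmx v)).

Fact prod_chart_dom_open : open prod_chart_dom.
Proof. by apply: open_prod; exact: chart_dom_open. Qed.

Fact prod_chart_image_open : open (prod_chart_map @` prod_chart_dom).
Proof. by rewrite prod_imageE; apply: prod_dom_open; exact: chart_image_open. Qed.

Fact prod_chart_mapK p : prod_chart_dom p -> prod_chart_inv (prod_chart_map p) = p.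
Proof.
case: p => x y [/= cx cy].
by rewrite /prod_chart_inv row_mxKl row_mxKr !chart_mapK.
Qed.

Fact prod_chart_map_continuous p : prod_chart_dom p -> {for p, continuous prod_chart_map}.
Proof.
case: p => x y [/= cx cy].
have -> : prod_chart_map = (fun p => row_mx (chart_map c p.1) 0 + row_mx 0 (chart_map c' p.2)).
  by apply/funext => p; rewrite add_row_mx addr0 add0r.
have rl_lin : linear (fun A : 'rV[R]_m => row_mx A 0 : 'rV[R]_(m + m')).
  by move=> a A B; rewrite scale_row_mx add_row_mx scaler0 addr0.
have rr_lin : linear (fun A : 'rV[R]_m' => row_mx 0 A : 'rV[R]_(m + m')).
  by move=> a A B; rewrite scale_row_mx add_row_mx scaler0 addr0.
pose rlM := GRing.isLinear.Build _ _ _ _ _ rl_lin.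
pose rl : {linear 'rV[R]_m -> 'rV[R]_(m + m')} :=
  HB.pack (fun A : 'rV[R]_m => row_mx A 0 : 'rV[R]_(m + m')) rlM.
pose rrM := GRing.isLinear.Build _ _ _ _ _ rr_lin.
pose rr : {linear 'rV[R]_m' -> 'rV[R]_(m + m')} :=
  HB.pack (fun A : 'rV[R]_m' => row_mx 0 A : 'rV[R]_(m + m')) rrM.
apply: continuousD.
  apply: (@continuous_comp _ _ _ (chart_map c \o fst) rl); last first.
    exact: mx_linear_continuous.
  by apply: continuous_comp; [exact: cvg_fst|exact: chart_map_continuous].
apply: (@continuous_comp _ _ _ (chart_map c' \o snd) rr); last first.
  exact: mx_linear_continuous.
by apply: continuous_comp; [exact: cvg_snd|exact: chart_map_continuous].
Qed.

Fact prod_chart_inv_continuous v : (prod_chart_map @` prod_chart_dom) v -> {for v, continuous prod_chart_inv}.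
Proof.
rewrite prod_imageE => -[cv cv'].
have iC : {for v, continuous (chart_inv c \o lsubmx)}.
  by apply: continuous_comp; [exact: continuous_lsubmx|exact: chart_inv_continuous].
have iC' : {for v, continuous (chart_inv c' \o rsubmx)}.
  by apply: continuous_comp; [exact: continuous_rsubmx|exact: chart_inv_continuous].
exact: cvg_pair iC iC'.
Qed.

Definition prod_chart : chart R (m + m') (T * T')%type :=
  Chart prod_chart_dom_open prod_chart_image_open prod_chart_mapK prod_chart_map_continuous prod_chart_inv_continuous.

Lemma prod_chart_image :
  chart_image prod_chart = prod_dom (chart_image c) (chart_image c').
Proof. exact: prod_imageE. Qed.

End ProdChart.

Definition prod_map (A B A' B' : Type) (f : A -> B) (f' : A' -> B') (p : A * A') :=
  (f p.1, f' p.2).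

Section LocalProd.
Variables (m n m' n' : nat) (T1 T2 T1' T2' : topologicalType).
Variables (c : chart R m T1) (d : chart R n T2).
Variables (c' : chart R m' T1') (d' : chart R n' T2').
Variables (f : T1 -> T2) (f' : T1' -> T2').

Lemma local_expr_prod :
  local_expr (prod_chart c c') (prod_chart d d') (prod_map f f') =
  prod_fun (local_expr c d f) (local_expr c' d' f').
Proof. by []. Qed.

Lemma local_dom_prod :
  local_dom (prod_chart c c') (prod_chart d d') (prod_map f f') =
  prod_dom (local_dom c d f) (local_dom c' d' f').
Proof.
rewrite -prod_imageE /local_dom; congr (_ @` _).
by apply/seteqP; split=> -[x y] [[/= ? ?] [/= ? ?]].
Qed.

Lemma smooth_local_prod : continuous f -> continuous f' ->
  smooth_on (local_dom c d f) (local_expr c d f) ->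
  smooth_on (local_dom c' d' f') (local_expr c' d' f') ->
  smooth_on (local_dom (prod_chart c c') (prod_chart d d') (prod_map f f'))
            (local_expr (prod_chart c c') (prod_chart d d') (prod_map f f')).
Proof.
move=> fC f'C fs f's; rewrite local_dom_prod local_expr_prod.
by apply: smooth_prod_fun => //; exact: local_dom_open.
Qed.

End LocalProd.

Lemma prod_map_id (A B : Type) : prod_map (@id A) (@id B) = id.
Proof. by apply/funext => -[]. Qed.

Section ProdManifold.
Variables (m n : nat) (M : manifold R m) (N : manifold R n).

Fact prod_atlas_cover (p : M * N) : exists i : atlas M * atlas N,
  chart_dom (prod_chart (chart_at i.1) (chart_at i.2)) p.
Proof.
have [i ip] := atlas_cover p.1; have [j jp] := atlas_cover p.2.
by exists (i, j).
Qed.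

Fact prod_atlas_compat (i j : atlas M * atlas N) :
  let c := prod_chart (chart_at i.1) (chart_at i.2) in
  let d := prod_chart (chart_at j.1) (chart_at j.2) in
  smooth_on (local_dom c d id) (local_expr c d id).
Proof.
move=> c d; rewrite -prod_map_id.
by apply: smooth_local_prod; try exact: atlas_compat; move=> ?; exact: cvg_id.
Qed.

Definition prod_manifold : manifold R (m + n) :=
  Manifold (hausdorff_prod (@manifold_hausdorff _ _ M) (@manifold_hausdorff _ _ N))
    (second_countable_prod (@manifold_second_countable _ _ M)
       (@manifold_second_countable _ _ N))
    prod_atlas_cover prod_atlas_compat.

End ProdManifold.

Lemma local_dom_in m n (M : manifold R m) (N : manifold R n) (f : M -> N)
    (i : atlas M) (j : atlas N) p :
  chart_dom (chart_at i) p -> chart_dom (chart_at j) (f p) ->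
  local_dom (chart_at i) (chart_at j) f (chart_map (chart_at i) p).
Proof. by move=> ip jp; exists p. Qed.

Lemma differentiable_local m n (M : manifold R m) (N : manifold R n) (f : M -> N)
    (i : atlas M) (j : atlas N) p : smooth_map f ->
  chart_dom (chart_at i) p -> chart_dom (chart_at j) (f p) ->
  differentiable (local_expr (chart_at i) (chart_at j) f) (chart_map (chart_at i) p).
Proof.
move=> [_ fs] ip jp; apply: smooth_differentiable (fs i j) _.
exact: local_dom_in.
Qed.

Lemma smooth_id n (M : manifold R n) : smooth_map (@id M).
Proof. by split=> [x|]; [exact: cvg_id|exact: atlas_compat]. Qed.

Lemma jacobian_at_comp m n q (M : manifold R m) (N : manifold R n)
    (P : manifold R q) (f : M -> N) (g : N -> P) i j k p :
  smooth_map f -> smooth_map g ->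
  chart_dom (chart_at i) p -> chart_dom (chart_at j) (f p) ->
  chart_dom (chart_at k) (g (f p)) ->
  jacobian_at (g \o f) i k p = jacobian_at f i j p *m jacobian_at g j k (f p).
Proof.
move=> fs gs ip jp kp.
have df := differentiable_local fs ip jp; have dg := differentiable_local gs jp kp.
set F := local_expr _ _ f in df; set G := local_expr _ _ g in dg.
set x := chart_map _ p in df.
have Fx : F x = chart_map (chart_at j) (f p).
  by rewrite /F /local_expr /= chart_mapK.
rewrite -Fx in dg.
have dGF := differentiable_comp df dg.
have nGF : \near x, (G \o F) x = local_expr (chart_at i) (chart_at k) (g \o f) x.
  have oD : open (local_dom (chart_at i) (chart_at j) f).
    by apply: local_dom_open; case: fs.
  have Dx := local_dom_in ip jp.
  apply: filterS (open_nbhs_nbhs (conj oD Dx)) => _ [r [ir jr] <-].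
  by rewrite /G /F /local_expr /= !chart_mapK.
have dH := near_eq_differentiable nGF dGF.
apply/row_matrixP => a; rewrite !rowE mulmxA /jacobian_at -/F -/G -/x.
rewrite -(deriveEjacobian _ dH) -(near_eq_derive _ nGF) (deriveE _ dGF).
rewrite (diff_comp df dg) /= -(deriveE _ df) (deriveEjacobian _ df).
by rewrite -(deriveE _ dg) (deriveEjacobian _ dg) Fx.
Qed.

Lemma jacobian_at_id n (M : manifold R n) (i : atlas M) p :
  chart_dom (chart_at i) p -> jacobian_at (@id M) i i p = 1%:M.
Proof.
move=> ip; have dI := differentiable_local (smooth_id M) ip ip.
apply/row_matrixP => a; rewrite !rowE mulmx1 -(deriveEjacobian _ dI).
rewrite -[RHS](derive_id (chart_map (chart_at i) p)); apply: near_eq_derive.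
have Dx := local_dom_in (f := id) ip ip.
have oD : open (local_dom (chart_at i) (chart_at i) id).
  by apply: local_dom_open => x; exact: cvg_id.
apply: filterS (open_nbhs_nbhs (conj oD Dx)) => _ [r [ir jr] <-].
by rewrite /local_expr /= !chart_mapK.
Qed.

Lemma jacobian_at_prod m n m' n' (M : manifold R m) (N : manifold R n)
    (M' : manifold R m') (N' : manifold R n') (f : M -> N) (f' : M' -> N')
    (i : atlas (prod_manifold M M')) (j : atlas (prod_manifold N N'))
    (p : prod_manifold M M') :
  smooth_map f -> smooth_map f' ->
  chart_dom (chart_at i) p ->
  chart_dom (chart_at j) (prod_map f f' p : prod_manifold N N') ->
  jacobian_at (prod_map f f' : prod_manifold M M' -> prod_manifold N N') i j p =
  block_mx (jacobian_at f i.1 j.1 p.1) 0 0 (jacobian_at f' i.2 j.2 p.2).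
Proof.
case: p i j => [x y] [i i'] [j j'] fs f's [/= ix i'y] [/= jx j'y].
have df := differentiable_local fs ix jx.
have df' := differentiable_local f's i'y j'y.
rewrite /jacobian_at /= local_expr_prod /prod_chart_map /=.
set v := row_mx _ _.
have [||_ ->] := @diff_prod_fun _ _ _ _ (local_expr (chart_at i) (chart_at j) f)
  (local_expr (chart_at i') (chart_at j') f') v.
- by rewrite /v row_mxKl.
- by rewrite /v row_mxKr.
by rewrite /v row_mxKl row_mxKr.
Qed.

Section Warped.
Variables (m n : nat) (L : manifold R m) (N : manifold R n).
Variables (h : metric_tensor L) (g : metric_tensor N).
Variables (w : L -> R) (w_smooth : smooth_fun w) (w_gt0 : forall x, 0 < w x).

Local Notation M := (prod_manifold L N).

Definition warped_mx (i : atlas M) (p : M) : 'M[R]_(m + n) :=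
  block_mx (h i.1 p.1) 0 0 (w p.1 *: g i.2 p.2).

Fact warped_mx_smooth i :
  smooth_on (chart_image (chart_at i)) (warped_mx i \o chart_inv (chart_at i)).
Proof.
case: i => [i j]; rewrite prod_chart_image /=.
set U := chart_image _; set U' := chart_image _.
have oU : open U by exact: chart_image_open.
have oU' : open U' by exact: chart_image_open.
have oUU' := prod_dom_open oU oU'.
pose H x := h i (chart_inv (chart_at i) x).
pose G x := g j (chart_inv (chart_at j) x).
pose wi x := w (chart_inv (chart_at i) x).
have -> : warped_mx (i, j) \o chart_inv (prod_chart (chart_at i) (chart_at j)) =
  (fun v => block_mx (H (lsubmx v)) 0 0 (0 : 'M_n) +
            block_mx (0 : 'M_m) 0 0 (wi (lsubmx v) *: G (rsubmx v))).
  by apply/funext => v /=; rewrite add_block_mx !addr0 add0r.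
apply: smoothD => //.
  apply: (@smooth_mx_linear _ _ _ _ _ _ (fun A => block_mx A 0 0 (0 : 'M_n))) => //.
    by move=> a A B; rewrite scale_block_mx add_block_mx !scaler0 !addr0.
  by apply: smooth_lsubmx => //; exact: metric_smooth.
apply: (@smooth_mx_linear _ _ _ _ _ _ (fun A => block_mx (0 : 'M_m) 0 0 A)) => //.
  by move=> a A B; rewrite scale_block_mx add_block_mx !scaler0 !addr0.
apply: smoothZ => //; first by apply: smooth_lsubmx => //; exact: w_smooth.
by apply: smooth_rsubmx => //; exact: metric_smooth.
Qed.

Fact warped_mx_sym i p : chart_dom (chart_at i) p -> (warped_mx i p)^T = warped_mx i p.
Proof.
by move=> [ip jp]; rewrite tr_block_mx !trmx0 linearZ /= !metric_sym.
Qed.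

Fact warped_mx_nondegenerate i p : chart_dom (chart_at i) p -> warped_mx i p \in unitmx.
Proof.
move=> [ip jp]; rewrite unitmxE det_ublock unitrM -!unitmxE.
rewrite metric_nondegenerate //= unitmxZ ?metric_nondegenerate //.
by rewrite unitfE gt_eqF.
Qed.

Fact warped_mx_change i j p : chart_dom (chart_at i) p -> chart_dom (chart_at j) p ->
  warped_mx i p = jacobian_at (@id M) i j p *m warped_mx j p *m (jacobian_at (@id M) i j p)^T.
Proof.
move=> ip jp; have := jacobian_at_prod (smooth_id L) (smooth_id N) ip (j := j).
rewrite prod_map_id => ->//; case: ip jp => [i1 i2] [j1 j2].
rewrite tr_block_mx !mulmx_block !trmx0 !(mulmx0, mul0mx, addr0, add0r).
by rewrite /warped_mx (metric_change h i1 j1) (metric_change g i2 j2) -scalemxAr -scalemxAl.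
Qed.

Definition warped_metric : metric_tensor M :=
  MetricTensor warped_mx_smooth warped_mx_sym warped_mx_nondegenerate warped_mx_change.

End Warped.

Section ProdSubmanifold.
Variables (m n k : nat) (L : manifold R m) (N : manifold R n).
Variable S : submanifold k N.

Local Notation P := (prod_manifold L S).
Local Notation M := (prod_manifold L N).
Definition prod_incl : P -> M := prod_map id (@incl _ _ _ _ S).

Fact prod_incl_injective : injective prod_incl.
Proof. by move=> [x s] [y t] [-> /incl_injective ->]. Qed.

Fact prod_incl_smooth : smooth_map prod_incl.
Proof.
have [iC iS] := incl_smooth S; have [idC idS] := smooth_id L.
split=> [[x s]|i j]; last exact: smooth_local_prod.
apply: cvg_pair => /=; first exact: cvg_fst.
have isC : {for (x, s), continuous (@incl _ _ _ _ S \o snd)}.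
  by apply: continuous_comp; [exact: cvg_snd|exact: iC].
exact: isC.
Qed.

Fact prod_incl_immersion (i : atlas P) (j : atlas M) (p : P) :
  chart_dom (chart_at i) p -> chart_dom (chart_at j) (prod_incl p) ->
  row_free (jacobian_at prod_incl i j p).
Proof.
move=> ip jp; rewrite jacobian_at_prod //; first last.
- exact: incl_smooth.
- exact: smooth_id.
case: ip jp => [i1 i2] [j1 j2].
have /row_freeP[B BE] := incl_immersion i2 j2.
have AE : jacobian_at (@id L) i.1 j.1 p.1 *m jacobian_at (@id L) j.1 i.1 p.1 = 1%:M.
  rewrite -(jacobian_at_comp (f := id) (g := id)) ?jacobian_at_id //; exact: smooth_id.
apply/row_freeP; exists (block_mx (jacobian_at id j.1 i.1 p.1) 0 0 B).
by rewrite mulmx_block !(mulmx0, mul0mx, addr0, add0r) AE BE -scalar_mx_block.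
Qed.

Definition prod_submanifold : submanifold (m + k) M :=
  Submanifold prod_incl_injective prod_incl_smooth prod_incl_immersion.

End ProdSubmanifold.

End Product.

(* Main.v *)
Require Import Defs.
From HB Require Import structures.
From mathcomp Require Import all_boot all_order all_algebra.
From mathcomp Require Import mathcomp_extra boolp classical_sets functions.
From mathcomp Require Import cardinality reals topology normedtype landau derive.

Set Implicit Arguments.
Unset Strict Implicit.
Unset Printing Implicit Defensive.

Import Order.TTheory GRing.Theory Num.Theory.
Import numFieldNormedType.Exports.

Local Open Scope classical_set_scope.
Local Open Scope ring_scope.

(* The L-component of the condition is void, since T_x L is contained in the
   tangent space of L x S. For the N-component, a vector field X on L x S is
   restricted to the slice {x} x S: this gives a vector field X_x on S, and
     (nabla_X Y)_N = nabla_(X_x) Y_x + D_(X_L) Y_S + dw(X_L)/2w Y_S + dw(Y_L)/2w X_S,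
   whose last three terms are tangent to S. Hence L x S is geodesic when S is;
   conversely each field X on S is the slice of the field (0, X) on L x S. *)

(** * Calculus in coordinates: slices, Jacobians and matrix products *)

Section Calculus.
Variable R : realType.

Lemma near_chart n (T : topologicalType) (c : chart R n T) p (P : set 'rV[R]_n) :
  chart_dom c p -> (forall q, chart_dom c q -> P (chart_map c q)) ->
  \forall v \near chart_map c p, P v.
Proof.
move=> cp cP; have Up : chart_image c (chart_map c p) by exists p.
have oU : open (chart_image c) by exact: chart_image_open.
by apply: filterS (open_nbhs_nbhs (conj oU Up)) => _ [q cq <-]; exact: cP.
Qed.

Lemma derive_mx_linear (V W : normedModType R) m n (f : V -> 'M[R]_(m, n))
    (l : 'M[R]_(m, n) -> W) (x v : V) :
  linear l -> differentiable f x -> 'D_v (fun y => l (f y)) x = l ('D_v f x).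
Proof.
move=> linl df; pose lM := GRing.isLinear.Build _ _ _ _ _ linl.
pose l' : {linear _ -> _} := HB.pack l lM.
have lC : continuous l' := mx_linear_continuous (l := l').
have dl y : differentiable l' y := linear_differentiable y lC.
rewrite -[LHS]/('D_v (l' \o f) x) deriveE; last exact: differentiable_comp.
by rewrite (diff_comp df (dl _)) (diff_lin _ lC) (deriveE _ df).
Qed.

(** A move along [row_mx 0 e] leaves the first factor fixed, so both difference quotients are the
    same function of [t]. *)
Lemma derive_rslice m n (W : normedModType R) (f : 'rV[R]_(m + n) -> W) v u e :
  'D_(row_mx 0 e) f (row_mx v u) = 'D_e (fun u' => f (row_mx v u')) u.
Proof.
rewrite /derive; apply: (congr1 (fun F : R -> W => lim (F @ 0^'))); apply/funext => t /=.
by rewrite scale_row_mx scaler0 add_row_mx add0r.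
Qed.

Lemma derive_lslice m n (W : normedModType R) (f : 'rV[R]_(m + n) -> W) v u e :
  'D_(row_mx e 0) f (row_mx v u) = 'D_e (fun v' => f (row_mx v' u)) v.
Proof.
rewrite /derive; apply: (congr1 (fun F : R -> W => lim (F @ 0^'))); apply/funext => t /=.
by rewrite scale_row_mx scaler0 add_row_mx add0r.
Qed.

Lemma differentiable_rslice m n (W : normedModType R) (f : 'rV[R]_(m + n) -> W) v u :
  differentiable f (row_mx v u) -> differentiable (fun u' => f (row_mx v u')) u.
Proof.
move=> df.
have rE : row_mx v = cst (row_mx v 0) + (fun u' : 'rV[R]_n => row_mx 0 u').
  by apply/funext => u'; rewrite !fctE add_row_mx addr0 add0r.
have rr_lin : linear (fun A : 'rV[R]_n => row_mx 0 A : 'rV[R]_(m + n)).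
  by move=> a A B; rewrite scale_row_mx add_row_mx scaler0 addr0.
pose rrM := GRing.isLinear.Build _ _ _ _ _ rr_lin.
pose rr : {linear 'rV[R]_n -> 'rV[R]_(m + n)} :=
  HB.pack (fun A : 'rV[R]_n => row_mx 0 A : 'rV[R]_(m + n)) rrM.
have dr : differentiable (row_mx v : 'rV[R]_n -> 'rV[R]_(m + n)) u.
  rewrite rE; apply: differentiableD; first exact: differentiable_cst.
  exact: (linear_differentiable u (mx_linear_continuous (l := rr))).
exact: (@differentiable_comp _ _ _ _ (row_mx v) f).
Qed.

(** One order of smoothness is given up so that, in the base case, continuity of the slice follows
    from its differentiability. This costs nothing for [smooth_on], which quantifies over all
    orders. *)
Lemma Ck_rslice m n (W : normedModType R) k (U : set 'rV[R]_(m + n))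
    (f : 'rV[R]_(m + n) -> W) v :
  Ck k.+1 U f -> Ck k (row_mx v @^-1` U) (fun u => f (row_mx v u)).
Proof.
elim: k f => [|k IHk] f [fd fC].
  by move=> u Uu; apply: differentiable_continuous; apply: differentiable_rslice; exact: fd.
split=> [u Uu|e]; first by apply: differentiable_rslice; exact: fd.
have -> : 'D_e (fun u => f (row_mx v u)) = (fun u => 'D_(row_mx 0 e) f (row_mx v u)).
  by apply/funext => u; rewrite derive_rslice.
exact: (IHk ('D_(row_mx 0 e) f) (fC _)).
Qed.

Lemma smooth_rslice m n (W : normedModType R) (U : set 'rV[R]_(m + n))
    (f : 'rV[R]_(m + n) -> W) v :
  smooth_on U f -> smooth_on (row_mx v @^-1` U) (fun u => f (row_mx v u)).
Proof. by move=> fs k; exact: Ck_rslice. Qed.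

(** The Jacobian is a sum of matrices with a single nonzero row, the [a]-th one being the [a]-th
    partial derivative, and [Ck] at order [l.+1] contains [Ck] at order [l] of every directional
    derivative. *)
Lemma smooth_jacobian m n (U : set 'rV[R]_m) (f : 'rV[R]_m -> 'rV[R]_n) :
  open U -> smooth_on U f -> smooth_on U (fun x => 'J f x).
Proof.
move=> oU fs k.
apply: (@Ck_eq _ _ _ _ _ (fun x => \sum_(a < m) delta_mx a 0 *m 'D_(delta_mx 0 a) f x)) => //.
  move=> x Ux; have df : differentiable f x by apply: (smooth_differentiable fs Ux).
  rewrite -[RHS]mul1mx mx1_sum_delta mulmx_suml; apply: eq_bigr => a _.
  by rewrite deriveEjacobian // mulmxA mul_delta_mx.
apply: Ck_sum => // a.
apply: (@smooth_mx_linear _ _ _ _ _ _ _ (fun A => delta_mx a 0 *m A)) => //.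
  by move=> c A B; rewrite linearP.
by move=> l; have [_] := fs l.+1; apply.
Qed.

(** Expanding the left factor over the elementary matrices leaves scalar functions times fixed
    linear images of [g]. *)
Lemma smooth_mulmx (V : normedModType R) m n p (U : set V)
    (f : V -> 'M[R]_(m, n)) (g : V -> 'M[R]_(n, p)) :
  open U -> smooth_on U f -> smooth_on U g -> smooth_on U (fun x => f x *m g x).
Proof.
move=> oU fs gs k.
have -> : (fun x => f x *m g x) =
    (fun x => \sum_i \sum_j f x i j *: (delta_mx i j *m g x)).
  apply/funext => x; rewrite {1}[f x]matrix_sum_delta mulmx_suml.
  apply: eq_bigr => i _; rewrite mulmx_suml.
  by apply: eq_bigr => j _; rewrite scalemxAl.
apply: Ck_sum => // i; apply: Ck_sum => // j; move: k; apply: smoothZ => //.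
  by apply: (@smooth_mx_linear _ _ _ _ _ _ _ (fun A => A i j)) => // a A B; rewrite !mxE.
apply: (@smooth_mx_linear _ _ _ _ _ _ _ (fun A => delta_mx i j *m A)) => //.
by move=> a A B; rewrite linearP.
Qed.

End Calculus.

(** * Vector fields on a product: slices over a point of [L], and lifts from [S] *)

Section Fields.
Variables (R : realType) (m k : nat) (L : manifold R m) (S : manifold R k).
Local Notation P := (prod_manifold L S).

Lemma jacobian_at_prod_id (i j : atlas P) (p : P) :
  chart_dom (chart_at i) p -> chart_dom (chart_at j) p ->
  jacobian_at (@id P) i j p =
  block_mx (jacobian_at (@id L) i.1 j.1 p.1) 0 0 (jacobian_at (@id S) i.2 j.2 p.2).
Proof.
by have := jacobian_at_prod (smooth_id L) (smooth_id S) (i := i) (j := j) (p := p);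
  rewrite prod_map_id.
Qed.

Section Slice.
Variables (X : vector_field P) (x : L) (i : atlas L).
Hypothesis ix : chart_dom (chart_at i) x.

(** The choice of the chart [i] around [x] is immaterial: chart changes of a product are block
    diagonal, so the [S]-components ignore changes of chart on [L]. *)
Definition slice_comp (j : atlas S) (s : S) : 'rV[R]_k :=
  rsubmx (X ((i, j) : atlas P) ((x, s) : P)).

Fact slice_smooth j :
  smooth_on (chart_image (chart_at j)) (slice_comp j \o chart_inv (chart_at j)).
Proof.
have Xs := vf_smooth X ((i, j) : atlas P).
have := smooth_rslice (chart_map (chart_at i) x) Xs.
rewrite prod_chart_image => Xvs.
apply: (@smooth_mx_linear _ _ _ _ _ _
  (fun u => X ((i, j) : atlas P) ((x, chart_inv (chart_at j) u) : P)) rsubmx).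
- exact: chart_image_open.
- by move=> a A B; rewrite linearP.
- move=> l; have := Xvs l; rewrite /comp /= /prod_chart_inv.
  under eq_fun do rewrite row_mxKl row_mxKr chart_mapK //.
  by apply: Ck_subset => u Uu; split; rewrite /= ?row_mxKl ?row_mxKr //; exists x.
Qed.

Fact slice_change j j' s :
  chart_dom (chart_at j) s -> chart_dom (chart_at j') s ->
  slice_comp j' s = slice_comp j s *m jacobian_at (@id S) j j' s.
Proof.
move=> js j's; rewrite /slice_comp.
rewrite (@vf_change _ _ _ X ((i, j) : atlas P) ((i, j') : atlas P)) //.
rewrite jacobian_at_prod_id //= -[X in X *m _]hsubmxK mul_row_block.
by rewrite row_mxKr mulmx0 add0r.
Qed.

Definition slice_field : vector_field S := VectorField slice_smooth slice_change.

End Slice.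

Section Lift.
Variable X : vector_field S.

Definition lift_comp (i : atlas P) (p : P) : 'rV[R]_(m + k) := row_mx 0 (X i.2 p.2).

Fact lift_smooth i :
  smooth_on (chart_image (chart_at i)) (lift_comp i \o chart_inv (chart_at i)).
Proof.
case: i => [i j]; rewrite prod_chart_image.
have oU : open (chart_image (chart_at i)) by exact: chart_image_open.
have oU' : open (chart_image (chart_at j)) by exact: chart_image_open.
apply: (@smooth_mx_linear _ _ _ _ _ _
  (fun v => X j (chart_inv (chart_at j) (rsubmx v))) (row_mx 0)).
- exact: prod_dom_open.
- by move=> a A B; rewrite scale_row_mx add_row_mx scaler0 addr0.
- exact: (@smooth_rsubmx _ _ _ _ _ _ (X j \o chart_inv (chart_at j)) oU' (vf_smooth X j)).
Qed.

Fact lift_change i j p :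
  chart_dom (chart_at i) p -> chart_dom (chart_at j) p ->
  lift_comp j p = lift_comp i p *m jacobian_at (@id P) i j p.
Proof.
move=> ip jp; rewrite jacobian_at_prod_id // /lift_comp mul_row_block !mul0mx.
rewrite mulmx0 !add0r; case: ip jp => [_ ip] [_ jp].
by rewrite (vf_change X ip jp).
Qed.

Definition lift_field : vector_field P := VectorField lift_smooth lift_change.

(** Only the component functions are compared, since [covariant_derivative] depends on a field
    through these alone. *)
Lemma slice_lift_field (x : L) i (ix : chart_dom (chart_at i) x) :
  slice_field lift_field ix = X :> (atlas S -> S -> 'rV[R]_k).
Proof.
by apply/funext => j; apply/funext => s; rewrite /= /slice_comp /lift_comp /= row_mxKr.
Qed.

End Lift.
End Fields.

(* dw(U) / 2w(x), for the tangent vector at x with components U in the chart j. *)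
Definition half_dlog (R : realType) m (L : manifold R m) (w : L -> R)
    (j : atlas L) (x : L) (U : 'rV[R]_m) : R :=
  \sum_a U 0 a *
    ((2 * w x)^-1 * pderiv a (w \o chart_inv (chart_at j)) (chart_map (chart_at j) x)).

(** * The [N]-components of the Christoffel symbols of the warped metric *)

Section WarpedChristoffel.
Variables (R : realType) (m n : nat) (L : manifold R m) (N : manifold R n).
Variables (h : metric_tensor L) (g : metric_tensor N).
Variables (w : L -> R) (w_smooth : smooth_fun w) (w_gt0 : forall x, 0 < w x).
Local Notation M := (prod_manifold L N).
Local Notation wg := (warped_metric h g w_smooth w_gt0).
Variables (j : atlas L) (j' : atlas N) (x : L) (y : N).
Hypotheses (jx : chart_dom (chart_at j) x) (j'y : chart_dom (chart_at j') y).

Let v := chart_map (chart_at j) x.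
Let u := chart_map (chart_at j') y.
Let G a b (z : 'rV[R]_(m + n)) :=
  wg ((j, j') : atlas M) (chart_inv (chart_at ((j, j') : atlas M)) z) a b.

Lemma pderiv_lshift (W : normedModType R) a (f : 'rV[R]_(m + n) -> W) v' u' :
  pderiv (lshift n a) f (row_mx v' u') = pderiv a (fun v => f (row_mx v u')) v'.
Proof. by rewrite /pderiv delta_mx_lshift derive_lslice. Qed.

Lemma pderiv_rshift (W : normedModType R) a (f : 'rV[R]_(m + n) -> W) v' u' :
  pderiv (rshift m a) f (row_mx v' u') = pderiv a (fun u => f (row_mx v' u)) u'.
Proof. by rewrite /pderiv delta_mx_rshift derive_rslice. Qed.

Let GE v' u' : wg ((j, j') : atlas M)
    (chart_inv (chart_at ((j, j') : atlas M)) (row_mx v' u')) =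
  block_mx (h j (chart_inv (chart_at j) v')) 0 0
    (w (chart_inv (chart_at j) v') *: g j' (chart_inv (chart_at j') u')).
Proof. by rewrite /= /warped_mx /prod_chart_inv /= row_mxKl row_mxKr. Qed.

Let pderiv0 q (a : 'I_q) (z : 'rV[R]_q) : pderiv a (fun=> 0 : R) z = 0.
Proof. exact: derive_cst. Qed.

Let gE (b d : 'I_n) u' := g j' (chart_inv (chart_at j') u') b d.
Let dw a := pderiv a (w \o chart_inv (chart_at j)) v.

Let gd b d : differentiable (gE b d) u.
Proof.
have oU : open (chart_image (chart_at j')) by exact: chart_image_open.
apply: (@smooth_differentiable _ _ _ (chart_image (chart_at j'))); last by exists y.
apply: (@smooth_mx_linear _ _ _ _ _ _ (fun u => g j' (chart_inv (chart_at j') u))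
  (fun A => A b d)) => //; last exact: metric_smooth.
by move=> a A B; rewrite !mxE.
Qed.

Let wd : differentiable (w \o chart_inv (chart_at j)) v.
Proof. by apply: (smooth_differentiable (w_smooth j)); exists x. Qed.

(** From here to [Grrr]: the blocks of the metric are [h], constant along [N], two zero blocks, and
    [w g], whose factors [w] and [g] are constant along [N] and along [L] respectively. *)
Let Gll a b d : pderiv (rshift m d) (G (lshift n a) (lshift n b)) (row_mx v u) = 0.
Proof.
rewrite pderiv_rshift /G; under eq_fun do rewrite GE block_mxEul.
exact: derive_cst.
Qed.

Let Glr a b d : pderiv d (G (lshift n a) (rshift m b)) (row_mx v u) = 0.
Proof.
have -> : G (lshift n a) (rshift m b) = cst 0.
  by apply/funext => z; rewrite /G -[z]hsubmxK GE block_mxEur mxE.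
exact: derive_cst.
Qed.

Let Grl a b d : pderiv d (G (rshift m a) (lshift n b)) (row_mx v u) = 0.
Proof.
have -> : G (rshift m a) (lshift n b) = cst 0.
  by apply/funext => z; rewrite /G -[z]hsubmxK GE block_mxEdl mxE.
exact: derive_cst.
Qed.

Let Grrl a b d : pderiv (lshift n a) (G (rshift m b) (rshift m d)) (row_mx v u) =
  dw a * g j' y b d.
Proof.
rewrite pderiv_lshift /G; under eq_fun do rewrite GE block_mxEdr mxE.
rewrite /u chart_mapK // /pderiv [LHS](@deriveMr _ _ (w \o chart_inv (chart_at j))).
  by rewrite mulrC.
exact: diff_derivable.
Qed.

Let Grrr a b d : pderiv (rshift m a) (G (rshift m b) (rshift m d)) (row_mx v u) =
  w x * pderiv a (gE b d) u.
Proof.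
rewrite pderiv_rshift /G; under eq_fun do rewrite GE block_mxEdr mxE.
rewrite /v chart_mapK // /pderiv [LHS](@deriveMl _ _ (gE b d)) //.
exact: diff_derivable.
Qed.

(** The inverse of a block diagonal metric is block diagonal, so the [N]-components involve only the
    indices [d] of [N] and the block [w^-1 g^-1]. *)
Let chrE a b : rsubmx (christoffel wg ((j, j') : atlas M) ((x, y) : M) a b) =
  2^-1 *: (\row_d (pderiv a (G b (rshift m d)) (row_mx v u) +
                   pderiv b (G a (rshift m d)) (row_mx v u) -
                   pderiv (rshift m d) (G a b) (row_mx v u))
           *m ((w x)^-1 *: invmx (g j' y))).
Proof.
have w0 : w x \is a GRing.unit by rewrite unitfE gt_eqF.
have wgu := metric_nondegenerate wg (i := ((j, j') : atlas M)) (p := ((x, y) : M)) (conj jx j'y).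
rewrite /christoffel linearZ; congr (_ *: _).
rewrite /= /warped_mx /= in wgu *.
rewrite invmx_block_diag // -invmxZ ?unitmxZ ?metric_nondegenerate //.
rewrite -[X in X *m _]hsubmxK mul_row_block row_mxKr mulmx0 add0r.
by congr (_ *m _); apply/rowP => d; rewrite !mxE.
Qed.

(** Every term is a derivative of a zero block or of [h] along [N]. Geometrically, the slices of [M]
    parallel to [L] are totally geodesic. *)
Lemma christoffel_warped_ll a b :
  rsubmx (christoffel wg ((j, j') : atlas M) ((x, y) : M) (lshift n a) (lshift n b)) = 0.
Proof.
rewrite chrE (_ : (\row_d _) = 0) ?mul0mx ?scaler0 //.
by apply/rowP => d; rewrite !mxE !Glr Gll addr0 subr0.
Qed.

(** Only the derivative of [w g] along [L] survives; it is a multiple of row [b] of [g], which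
    [g^-1] turns into a basis vector. *)
Lemma christoffel_warped_lr a b :
  rsubmx (christoffel wg ((j, j') : atlas M) ((x, y) : M) (lshift n a) (rshift m b)) =
  ((2 * w x)^-1 * pderiv a (w \o chart_inv (chart_at j)) (chart_map (chart_at j) x)) *:
    delta_mx 0 b.
Proof.
rewrite chrE (_ : (\row_d _) = dw a *: row b (g j' y)); last first.
  by apply/rowP => d; rewrite !mxE !Glr Grrl addr0 subr0.
rewrite -scalemxAl -scalemxAr rowE mulmxK ?metric_nondegenerate //.
by rewrite !scalerA invfM mulrAC.
Qed.

(** Along [N] the function [w] is a constant factor, cancelled by the [w^-1] of the inverse
    metric. *)
Lemma christoffel_warped_rr a b :
  rsubmx (christoffel wg ((j, j') : atlas M) ((x, y) : M) (rshift m a) (rshift m b)) =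
  christoffel g j' y a b.
Proof.
have w0 : w x != 0 by rewrite gt_eqF.
rewrite chrE /christoffel; congr (_ *: _).
rewrite -scalemxAr scalemxAl; congr (_ *m _); apply/rowP => d.
by rewrite !mxE !Grrr -mulrDr -mulrBr mulKf.
Qed.

Lemma sum_christoffel_warped (U1 V1 : 'rV[R]_m) (U2 V2 : 'rV[R]_n) :
  rsubmx (\sum_a \sum_b (row_mx U1 U2 0 a * row_mx V1 V2 0 b) *:
            christoffel wg ((j, j') : atlas M) ((x, y) : M) a b) =
  half_dlog w j x U1 *: V2 + half_dlog w j x V1 *: U2 +
  \sum_a \sum_b (U2 0 a * V2 0 b) *: christoffel g j' y a b.
Proof.
rewrite linear_sum big_split_ord /=.
have -> : \sum_(a < m) rsubmx (\sum_b
    (row_mx U1 U2 0 (lshift n a) * row_mx V1 V2 0 b) *: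
      christoffel wg ((j, j') : atlas M) ((x, y) : M) (lshift n a) b) = half_dlog w j x U1 *: V2.
  rewrite scaler_suml; apply: eq_bigr => a _; rewrite linear_sum big_split_ord /=.
  rewrite big1 => [|b _]; last by rewrite linearZ /= christoffel_warped_ll scaler0.
  rewrite add0r [V2 in RHS]row_sum_delta scaler_sumr; apply: eq_bigr => b _.
  by rewrite linearZ /= christoffel_warped_lr row_mxEl row_mxEr !scalerA mulrAC.
rewrite -addrA; congr (_ + _); rewrite [U2 in _ *: U2]row_sum_delta scaler_sumr -big_split.
apply: eq_bigr => a _; rewrite linear_sum big_split_ord /=; congr (_ + _).
  rewrite scalerA mulr_suml scaler_suml; apply: eq_bigr => b _.
  (* Torsion-freeness brings the symbols with first index in [N] and second in [L] back to the mixed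
     case already computed. *)
  rewrite linearZ /= christoffelC ?christoffel_warped_lr; last by split.
  by rewrite row_mxEl row_mxEr scalerA; congr (_ *: _); rewrite [_ * V1 0 b]mulrC mulrAC.
by apply: eq_bigr => b _; rewrite linearZ /= christoffel_warped_rr !row_mxEr.
Qed.

End WarpedChristoffel.

(** * Smoothness of a field along the inclusion *)

Section Push.
Variables (R : realType) (n k : nat) (N : manifold R n) (S : submanifold k N).

Lemma smooth_push (Y : vector_field S) (i : atlas S) (j : atlas N) :
  smooth_on (local_dom (chart_at i) (chart_at j) (@Defs.incl _ _ _ _ S))
            (push Y i j \o chart_inv (chart_at i)).
Proof.
have [iC iS] := incl_smooth S.
have oD := local_dom_open (c := chart_at i) (d := chart_at j) iC.
have Ys : smooth_on (local_dom (chart_at i) (chart_at j) (@Defs.incl _ _ _ _ S))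
                    (Y i \o chart_inv (chart_at i)).
  move=> l; apply: Ck_subset (vf_smooth Y i l) => _ [p [ip _] <-].
  by exists p.
have pushs := smooth_mulmx oD Ys (smooth_jacobian oD (iS i j)).
(* [push] takes the Jacobian at [chart_map] of [chart_inv z], which is [z] only for [z] in the chart
   image; hence the comparison on the open set alone. *)
move=> l; apply: (Ck_eq oD _ (pushs l)).
by move=> _ [p [ip jp] <-]; rewrite /push /jacobian_at /= chart_mapK.
Qed.

End Push.

(** * The covariant derivative along [L x S] modulo the tangent space of [S] *)

Section CovariantDerivative.
Variables (R : realType) (m n k : nat) (L : manifold R m) (N : manifold R n).
Variables (h : metric_tensor L) (g : metric_tensor N).
Variables (w : L -> R) (w_smooth : smooth_fun w) (w_gt0 : forall x, 0 < w x).
Variable S : submanifold k N.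
Local Notation P := (prod_manifold L S).
Local Notation M := (prod_manifold L N).
Local Notation LS := (prod_submanifold L S).
Local Notation wg := (warped_metric h g w_smooth w_gt0).

Lemma jacobian_prod_incl (i : atlas LS) (j : atlas M) (p : LS) :
  chart_dom (chart_at i) p -> chart_dom (chart_at j) (Defs.incl p) ->
  jacobian_at (@Defs.incl _ _ _ _ LS) i j p =
  block_mx (jacobian_at (@id L) i.1 j.1 p.1) 0 0
           (jacobian_at (@Defs.incl _ _ _ _ S) i.2 j.2 p.2).
Proof. by apply: jacobian_at_prod; [exact: smooth_id|exact: incl_smooth]. Qed.

Lemma push_prod (Y : vector_field LS) (i : atlas LS) (j : atlas M) (p : LS) :
  chart_dom (chart_at i) p -> chart_dom (chart_at j) (Defs.incl p) ->
  push Y i j p =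
  row_mx (lsubmx (Y i p) *m jacobian_at (@id L) i.1 j.1 p.1)
         (rsubmx (Y i p) *m jacobian_at (@Defs.incl _ _ _ _ S) i.2 j.2 p.2).
Proof.
move=> ip jp; rewrite /push jacobian_prod_incl // -[X in X *m _]hsubmxK.
by rewrite mul_row_block !mulmx0 addr0 add0r.
Qed.

(** The term in [u] is tangent to [S], being in the row space of the Jacobian. The charts [i] and
    [j] of [L] may differ, because [geodesic] chooses the charts of source and target
    independently. *)
Lemma rsubmx_covariant_derivative (X Y : vector_field LS) (i j : atlas L)
    (i' : atlas S) (j' : atlas N) (x : L) (s : S)
    (ix : chart_dom (chart_at i) x) (jx : chart_dom (chart_at j) x)
    (i's : chart_dom (chart_at i') s) (j's : chart_dom (chart_at j') (Defs.incl s)) :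
  exists u : 'rV[R]_k,
    rsubmx (covariant_derivative wg X Y ((i, i') : atlas LS) ((j, j') : atlas M)
              ((x, s) : LS)) =
    covariant_derivative g (slice_field X ix) (slice_field Y ix) i' j' s +
    u *m jacobian_at (@Defs.incl _ _ _ _ S) i' j' s.
Proof.
pose ii : atlas LS := (i, i'); pose jj : atlas M := (j, j'); pose p : LS := (x, s).
have ip : chart_dom (chart_at ii) p by split.
have jp : chart_dom (chart_at jj) (Defs.incl p) by split.
set J := jacobian_at _ _ _ s.
pose v := chart_map (chart_at i) x; pose u := chart_map (chart_at i') s.
have invE v' u' : chart_inv (chart_at ii) (row_mx v' u') =
    ((chart_inv (chart_at i) v', chart_inv (chart_at i') u') : LS).
  by rewrite /= /prod_chart_inv row_mxKl row_mxKr.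
(* [F] is the [S]-part of [Y] in the chart of [S]; [Q] below is the [N]-part of its image in the
   chart of [N]. *)
pose F z := rsubmx (Y ii (chart_inv (chart_at ii) z)).
have dF : differentiable F (row_mx v u).
  apply: (@smooth_differentiable _ _ _ (chart_image (chart_at ii))); last by exists p.
  apply: (@smooth_mx_linear _ _ _ _ _ _ (Y ii \o chart_inv (chart_at ii)) rsubmx).
  - exact: chart_image_open.
  - by move=> a A B; rewrite linearP.
  - exact: vf_smooth.
pose Q z := rsubmx (push Y ii jj (chart_inv (chart_at ii) z)).
have dpush : differentiable (push Y ii jj \o chart_inv (chart_at ii)) (row_mx v u).
  by apply: smooth_differentiable (smooth_push Y ii jj) _; exists p.
have linr : linear (rsubmx : 'rV[R]_(m + n) -> 'rV[R]_n).
  by move=> a A B; rewrite linearP.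
have dQ : differentiable Q (row_mx v u).
  exact: (differentiable_comp dpush (differentiable_rsubmx _)).
pose X1 := lsubmx (X ii p); pose X2 := rsubmx (X ii p).
have DX : rsubmx ('D_(X ii p) (push Y ii jj \o chart_inv (chart_at ii)) (row_mx v u)) =
    'D_(row_mx X1 0) Q (row_mx v u) + 'D_(row_mx 0 X2) Q (row_mx v u).
  rewrite -(derive_mx_linear _ linr dpush) -/Q !deriveE // -linearD.
  by rewrite add_row_mx addr0 add0r hsubmxK.
(* Along [L] the point of [S] stays at [s], so the Jacobian of the inclusion is the constant [J] and
   comes out of the derivative. *)
have DX1 : 'D_(row_mx X1 0) Q (row_mx v u) = 'D_(row_mx X1 0) F (row_mx v u) *m J.
  have linJ : linear (mulmxr J : 'rV[R]_k -> 'rV[R]_n).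
    by move=> a A B; rewrite linearP.
  transitivity ('D_(row_mx X1 0) (fun z => F z *m J) (row_mx v u)); last first.
    exact: (derive_mx_linear _ linJ dF).
  rewrite !derive_lslice; apply: near_eq_derive.
  (* [push_prod] requires the point of [L] to lie in both charts [i] and [j], which holds near
     [v]. *)
  have jV : \forall v' \near v, chart_dom (chart_at j) (chart_inv (chart_at i) v').
    have ijx := local_dom_in ix (jx : chart_dom (chart_at j) (id x)).
    have oD : open (local_dom (chart_at i) (chart_at j) id).
      by apply: local_dom_open => ?; exact: cvg_id.
    apply: filterS (open_nbhs_nbhs (conj oD ijx)) => _ [q [iq jq] <-].
    by rewrite chart_mapK.
  have iV : \forall v' \near v, chart_dom (chart_at i) (chart_inv (chart_at i) v').
    by apply: near_chart ix _ => q iq; rewrite chart_mapK.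
  apply: filterS2 iV jV => v' iv' jv'.
  by rewrite /Q /F invE [chart_inv (chart_at i') u]chart_mapK // push_prod ?row_mxKr.
(* Along [S] the point of [L] stays at [x], where the [S]-part of [Y] is the slice field. *)
have DX2 : 'D_(row_mx 0 X2) Q (row_mx v u) =
    'D_X2 (push (slice_field Y ix) i' j' \o chart_inv (chart_at i')) u.
  rewrite derive_rslice; apply: near_eq_derive.
  have oD : open (local_dom (chart_at i') (chart_at j') (@Defs.incl _ _ _ _ S)).
    by apply: local_dom_open; case: (incl_smooth S).
  apply: filterS (open_nbhs_nbhs (conj oD (local_dom_in i's j's))) => _ [q [i'q j'q] <-].
  rewrite /Q invE [chart_inv (chart_at i) v](chart_mapK ix) [in RHS]/comp (chart_mapK i'q).
  rewrite push_prod; [|by []|by []].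
  rewrite row_mxKr /push /= /slice_comp.
  exact: erefl.
rewrite {1}/covariant_derivative linearD /= -/ii -/jj -/p.
rewrite [X in X + _]DX DX1 DX2 !push_prod //.
rewrite [X in _ + X](sum_christoffel_warped h g w_smooth w_gt0 jx j's).
set U1 := lsubmx (X ii p) *m _; set V1 := lsubmx (Y ii p) *m _.
(* The three tangential terms before multiplication by [J]; [U1] and [V1] are the [L]-parts of [X]
   and [Y] carried to the chart [j]. *)
exists ('D_(row_mx X1 0) F (row_mx v u) + half_dlog w j x U1 *: rsubmx (Y ii p) +
        half_dlog w j x V1 *: X2).
rewrite /covariant_derivative /push /= /slice_comp -/ii -/p -/u -/X2 -/J.
rewrite !mulmxDl -!scalemxAl [X in X + _ = _]addrC [X in _ + X = _]addrC addrACA.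
by congr (_ + _); rewrite addrA.
Qed.

End CovariantDerivative.

(** * Splitting the tangency condition, and the equivalence *)

Lemma row_mx_sub_diag (F : fieldType) m n p q (a : 'rV[F]_m) (b : 'rV[F]_n)
    (A : 'M[F]_(p, m)) (B : 'M[F]_(q, n)) :
  (row_mx a b <= block_mx A 0 0 B)%MS = (a <= A)%MS && (b <= B)%MS.
Proof.
apply/idP/andP => [/submxP[D]|[/submxP[C ->] /submxP[D ->]]].
  rewrite -[D]hsubmxK mul_row_block !mulmx0 addr0 add0r => /eq_row_mx[-> ->].
  by split; exact: submxMl.
by apply/submxP; exists (row_mx C D); rewrite mul_row_block !mulmx0 addr0 add0r.
Qed.

(** By the chain rule the reverse transition map provides an inverse. This is what makes the
    [L]-part of tangency void. *)
Lemma jacobian_at_id_full (R : realType) n (M : manifold R n) (i j : atlas M) p :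
  chart_dom (chart_at i) p -> chart_dom (chart_at j) p ->
  row_full (jacobian_at (@id M) i j p).
Proof.
move=> ip jp; apply/row_fullP; exists (jacobian_at (@id M) j i p).
rewrite -(jacobian_at_comp (f := id) (g := id)) ?jacobian_at_id //; exact: smooth_id.
Qed.

(* For L empty, L x S is empty, hence geodesic, whatever S is. *)
Theorem mainTheorem2 (R : realType) (m n k : nat)
    (L : manifold R m) (h : metric_tensor L)
    (N : manifold R n) (g : metric_tensor N)
    (w : L -> R) (w_smooth : smooth_fun w) (w_gt0 : forall x : L, 0 < w x)
    (S : submanifold k N) :
  [set: L] !=set0 ->
  geodesic g S <->
  geodesic (warped_metric h g w_smooth w_gt0) (prod_submanifold L S).
Proof.
move=> [x0 _]; split=> geo X Y.
  move=> [i i'] [j j'] [x s] [/= ix i's] [/= jx j's].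
  have [u covE] := rsubmx_covariant_derivative h g w_smooth w_gt0 X Y ix jx i's j's.
  rewrite jacobian_prod_incl // -[X in (X <= _)%MS]hsubmxK row_mx_sub_diag covE.
  rewrite submx_full ?jacobian_at_id_full // addmx_sub ?submxMl //.
  exact: geo.
(* A point [x0] of [L] is needed to place the slice; one chart [i] around it serves for both source
   and target. *)
move=> i' j' s i's j's; have [i ix] := atlas_cover x0.
have [u covE] := rsubmx_covariant_derivative h g w_smooth w_gt0
  (lift_field L X) (lift_field L Y) ix ix i's j's.
have := geo (lift_field L X) (lift_field L Y) ((i, i') : atlas (prod_manifold L S))
  ((i, j') : atlas (prod_manifold L N)) ((x0, s) : prod_manifold L S)
  (conj ix i's) (conj ix j's).
rewrite jacobian_prod_incl // -[X in (X <= _)%MS]hsubmxK row_mx_sub_diag covE.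
(* Subtracting the tangential remainder leaves the covariant derivative of the slices of the lifts,
   that is, of [X] and [Y] themselves. *)
move=> /andP[_ covJ]; have := addmx_sub covJ (submxMl (- u) _).
by rewrite mulNmx addrK /covariant_derivative /push !slice_lift_field.
Qed.
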